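(* Let $m,n,k\in\mathbb{N}$ and let $\varphi:\mathcal{B}(\mathbb{C}^m)\to\mathcal{B}(\mathbb{C}^n)$ be a linear map, with associated operators $h_{ij}=\varphi(E_{ij})\in\mathcal{B}(\mathbb{C}^n)$ ($i,j=1,\dots,m$) and $g_{pq}\in\mathcal{B}(\mathbb{C}^m)$ ($p,q=1,\dots,n$), the latter being the unique operators such that $\varphi(a)=\sum_{p,q=1}^n \mathrm{Tr}(a g_{qp})F_{pq}$ for all $a\in\mathcal{B}(\mathbb{C}^m)$. Then the following conditions are equivalent: (i) $\varphi$ is $k$-positive; (ii) for every $y_1,\dots,y_m\in\mathbb{C}^n$ such that $\dim\mathrm{span}\{y_1,\dots,y_m\}\le k$ we have $\sum_{i,j=1}^m\langle y_j,h_{ij}y_i\rangle\ge 0$; (iii) for every $x_1,\dots,x_n\in\mathbb{C}^m$ such that $\dim\mathrm{span}\{x_1,\dots,x_n\}\le k$ we have $\sum_{p,q=1}^n\langle x_p,g_{pq}^{t}x_q\rangle\ge 0$.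
   Context: Inner products are linear in the second variable. $(e_i)_{i=1}^m$ and $(f_p)_{p=1}^n$ are fixed orthonormal bases of $\mathbb{C}^m$ and $\mathbb{C}^n$. The matrix units $E_{ij}\in\mathcal{B}(\mathbb{C}^m)$ and $F_{pq}\in\mathcal{B}(\mathbb{C}^n)$ are indexed by the convention $E_{ij}x=\langle e_i,x\rangle e_j$ and $F_{pq}y=\langle f_p,y\rangle f_q$. For $a\in\mathcal{B}(\mathbb{C}^m)$, $a^t$ is the transpose with respect to $(e_i)$, i.e. $a^t=J_ca^*J_c$ where $J_c(\sum\lambda_ie_i)=\sum\overline{\lambda_i}e_i$. A linear map $\varphi:A\to B$ of $C^*$-algebras is $k$-positive if $\varphi_k:M_k(A)\to M_k(B)$, $\varphi_k([a_{ij}])=[\varphi(a_{ij})]$, maps positive elements to positive elements. *)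

(* Defs.v *)
From HB Require Import structures.
From mathcomp Require Import all_boot all_order all_algebra.
From mathcomp Require Import spectral.
From mathcomp Require Export complex reals.

Set Implicit Arguments.
Unset Strict Implicit.
Unset Printing Implicit Defensive.

Import GRing.Theory Num.Theory.
Local Open Scope ring_scope.
Local Open Scope sesquilinear_scope.

(* B(C^m) is 'M[C]_m acting on column vectors by a *m x; the Hilbert space
   adjoint of a is a ^t*, the conjugate transpose. *)

(* Linear in the second variable, unlike dotmx of spectral.v. *)
Definition inner (C : numClosedFieldType) (m : nat) (x y : 'cV[C]_m) : C :=
  (x ^t* *m y) 0 0.

(* The family has as many vectors as the dimension, so orthonormality alone
   makes it a basis. *)
Definition orthonormal_basis (C : numClosedFieldType) (m : nat)
    (e : 'I_m -> 'cV[C]_m) : Prop :=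
  forall i j, inner (e i) (e j) = (i == j)%:R.

(* The operator x |-> <e_i, x> e_j (see mx_unitE): with respect to the basis e
   its only nonzero entry is in row j and column i. *)
Definition mx_unit (C : numClosedFieldType) (m : nat)
    (e : 'I_m -> 'cV[C]_m) (i j : 'I_m) : 'M[C]_m :=
  e j *m (e i) ^t*.

(* The antilinear conjugation J_c attached to the basis e. *)
Definition basis_conj (C : numClosedFieldType) (m : nat)
    (e : 'I_m -> 'cV[C]_m) (x : 'cV[C]_m) : 'cV[C]_m :=
  \sum_(i < m) (inner (e i) x)^* *: e i.

(* a^t = J_c a^* J_c, the transpose with respect to the basis e, given by its
   action on vectors. *)
Definition basis_tr (C : numClosedFieldType) (m : nat)
    (e : 'I_m -> 'cV[C]_m) (a : 'M[C]_m) (x : 'cV[C]_m) : 'cV[C]_m :=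
  basis_conj e (a ^t* *m basis_conj e x).

(* Elements of M_k(B(C^m)) are k x k matrices with entries in the ring
   'M[C]_m. *)
Definition block_adj (C : numClosedFieldType) (m k : nat)
    (b : 'M['M[C]_m]_k) : 'M['M[C]_m]_k :=
  \matrix_(i, j) (b j i) ^t*.

(* Positivity in the C*-algebra M_k(B(C^m)): a = b^* b for some b. *)
Definition block_positive (C : numClosedFieldType) (m k : nat)
    (a : 'M['M[C]_m]_k) : Prop :=
  exists b : 'M['M[C]_m]_k, a = block_adj b *m b.

Definition k_positive (C : numClosedFieldType) (m n k : nat)
    (phi : 'M[C]_m -> 'M[C]_n) : Prop :=
  forall a : 'M['M[C]_m]_k, block_positive a -> block_positive (map_mx phi a).

Lemma mx_unitE (C : numClosedFieldType) (m : nat) (e : 'I_m -> 'cV[C]_m)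
    (i j : 'I_m) (x : 'cV[C]_m) :
  mx_unit e i j *m x = inner (e i) x *: e j.
Proof. by rewrite /mx_unit -mulmxA [_ ^t* *m x]mx11_scalar mul_mx_scalar. Qed.

Lemma orthonormal_sum (C : numClosedFieldType) (n : nat)
    (f : 'I_n -> 'cV[C]_n) : orthonormal_basis f ->
  \sum_(p < n) f p *m (f p) ^t* = 1%:M.
Proof.
move=> fon; pose U := \matrix_(i < n, j < n) f j i 0.
have UU : U ^t* *m U = 1%:M.
  apply/matrixP=> i j; rewrite !mxE -(fon i j) /inner mxE.
  by apply: eq_bigr => l _; rewrite !mxE.
rewrite -(mulmx1C UU); apply/matrixP=> i j; rewrite summxE !mxE.
by apply: eq_bigr => l _; rewrite !mxE big_ord1 !mxE.
Qed.

(* Every phi has exactly one family g with the trace representation, so assuming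
   that representation of a given g is the same as defining g from phi. *)
Lemma assoc_g_exists_unique (C : numClosedFieldType) (m n : nat)
    (f : 'I_n -> 'cV[C]_n) (fon : orthonormal_basis f)
    (phi : {linear 'M[C]_m -> 'M[C]_n}) :
  let rep (g : 'I_n -> 'I_n -> 'M[C]_m) :=
    forall a, phi a = \sum_(p < n) \sum_(q < n) \tr (a *m g q p) *: mx_unit f p q in
  (exists g, rep g) /\
  (forall g g', rep g -> rep g' -> forall p q, g p q = g' p q).
Proof.
move=> rep.
have coef g a p q : rep g -> inner (f q) (phi a *m f p) = \tr (a *m g q p).
  move=> ->; rewrite /inner mulmx_suml mulmx_sumr summxE (bigD1 p) //=.
  rewrite [X in _ + X]big1 => [|p' np]; last first.
    rewrite mulmx_suml mulmx_sumr summxE big1 // => q' _.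
    rewrite -scalemxAl mx_unitE fon (negPf np) scale0r scaler0.
    by rewrite mulmx0 mxE.
  rewrite addr0 mulmx_suml mulmx_sumr summxE (bigD1 q) //= big1 => [|q' nq].
    rewrite -scalemxAl mx_unitE fon eqxx scale1r -scalemxAr mxE.
    by rewrite -/(inner _ _) fon eqxx mulr1 addr0.
  rewrite -scalemxAl mx_unitE fon eqxx scale1r -scalemxAr mxE.
  by rewrite -/(inner _ _) fon eq_sym (negPf nq) mulr0.
split.
  exists (fun q p => \matrix_(i, j) inner (f q) (phi (delta_mx j i) *m f p)) => a.
  have trE p q : \tr (a *m \matrix_(i, j) inner (f q) (phi (delta_mx j i) *m f p))
      = inner (f q) (phi a *m f p).
    rewrite [in RHS](matrix_sum_delta a).
    rewrite [phi _]linear_sum mulmx_suml /inner mulmx_sumr summxE.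
    apply: eq_bigr => i _; rewrite mxE linear_sum mulmx_suml mulmx_sumr summxE.
    apply: eq_bigr => j _.
    by rewrite linearZ -scalemxAl -scalemxAr !mxE.
  rewrite -[LHS]mulmx1 -(orthonormal_sum fon) mulmx_sumr.
  apply: eq_bigr => p _; rewrite -[LHS]mul1mx -(orthonormal_sum fon) mulmx_suml.
  apply: eq_bigr => q _; rewrite trE /mx_unit !mulmxA.
  rewrite -[f q *m _ *m _ *m _]mulmxA -[f q *m _ *m (_ *m _)]mulmxA.
  by rewrite [_ ^t* *m (_ *m _)]mx11_scalar mul_mx_scalar -scalemxAl /inner.
move=> g g' Hg Hg' q p; apply/matrixP => i j.
have := coef g (delta_mx j i) p q Hg; rewrite (coef g' _ _ _ Hg').
have trd (M : 'M[C]_m) : \tr (delta_mx j i *m M) = M i j.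
  rewrite /mxtrace (bigD1 j) //= big1 => [|l nl]; rewrite mxE (bigD1 i) //= big1.
  - by rewrite !mxE !eqxx mul1r !addr0.
  - by move=> l nl; rewrite mxE (negPf nl) andbF mul0r.
  - by rewrite mxE (negPf nl) mul0r addr0.
  - by move=> l' _; rewrite mxE (negPf nl) mul0r.
by rewrite !trd.
Qed.

(* Main.v *)
(** For families v in (C^m)^k and w in (C^n)^k put
    Q(v, w) = sum_(s, t) <w_s, phi(v_s v_t^* ) w_t>.
    Every positive element of M_k(B(C^m)) is a sum of elements [v_s v_t^* ], so
    (i) says that Q >= 0 for all v and w. Expanding v_s and v_t in the basis e
    turns Q(v, w) into the sum of (ii) with y_i = sum_t <v_t, e_i> w_t;
    expanding w_s and w_t in the basis f turns it into the sum of (iii) with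
    J_c x_p = sum_t <w_t, f_p> v_t. As e and f are bases, the families of this
    shape are exactly those whose span has dimension at most k, a condition that
    J_c preserves. *)

Require Import Defs.
From mathcomp Require Import all_boot all_order all_algebra.
From mathcomp Require Import reals complex.
From mathcomp Require Import spectral ring.

Import GRing.Theory Num.Theory.
Local Open Scope ring_scope.
Local Open Scope sesquilinear_scope.

(** * Adjoints, the inner product and positive semidefinite matrices *)

Lemma trmxC_mul {C : numClosedFieldType} {m n p}
    (A : 'M[C]_(m, n)) (B : 'M_(n, p)) :
  (A *m B) ^t* = B ^t* *m A ^t*.
Proof. by rewrite trmx_mul map_mxM. Qed.

Lemma trmxC_delta {C : numClosedFieldType} {m n} i j :
  (delta_mx i j : 'M[C]_(m, n)) ^t* = delta_mx j i.
Proof. by rewrite trmx_delta map_delta_mx. Qed.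

Section Inner.
Context {C : numClosedFieldType} {m : nat}.
Implicit Types (x y z : 'cV[C]_m) (A : 'M[C]_m).

Lemma innerDr x y z : inner x (y + z) = inner x y + inner x z.
Proof. by rewrite /inner mulmxDr mxE. Qed.

Lemma innerZr c x y : inner x (c *: y) = c * inner x y.
Proof. by rewrite /inner -scalemxAr mxE. Qed.

Lemma inner_sumr (I : finType) x (y : I -> 'cV_m) :
  inner x (\sum_i y i) = \sum_i inner x (y i).
Proof. by rewrite /inner mulmx_sumr summxE. Qed.

Lemma inner_conj x y : (inner x y)^* = inner y x.
Proof.
rewrite /inner !mxE rmorph_sum; apply: eq_bigr => i _.
by rewrite rmorphM /= !mxE conjCK mulrC.
Qed.

Lemma innerDl x y z : inner (x + y) z = inner x z + inner y z.
Proof. by rewrite -inner_conj innerDr rmorphD /= !inner_conj. Qed.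

Lemma innerZl c x y : inner (c *: x) y = c^* * inner x y.
Proof. by rewrite -inner_conj innerZr rmorphM /= inner_conj. Qed.

Lemma inner_suml (I : finType) (x : I -> 'cV_m) y :
  inner (\sum_i x i) y = \sum_i inner (x i) y.
Proof.
rewrite -inner_conj inner_sumr rmorph_sum /=.
by apply: eq_bigr => i _; rewrite inner_conj.
Qed.

Lemma inner_ge0 x : 0 <= inner x x.
Proof.
rewrite /inner mxE; apply: sumr_ge0 => i _.
by rewrite !mxE mulrC mul_conjC_ge0.
Qed.

Lemma inner_adj {n} (A : 'M[C]_(m, n)) x (y : 'cV_n) :
  inner x (A *m y) = inner (A ^t* *m x) y.
Proof. by rewrite /inner trmxC_mul trmxCK mulmxA. Qed.

Lemma inner_delta A i j :
  inner (delta_mx i 0) (A *m delta_mx j 0) = A i j.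
Proof. by rewrite /inner trmxC_delta mulmxA -rowE -colE !mxE. Qed.

(* Polarization at e_j + e_i and e_j + 'i e_i. *)
Lemma psd_hermitian A : (forall x, 0 <= inner x (A *m x)) -> A ^t* = A.
Proof.
move=> A_ge0; apply/matrixP => i j; rewrite !mxE.
pose x : 'cV[C]_m := delta_mx j 0; pose y : 'cV[C]_m := delta_mx i 0.
have real z : (inner z (A *m z))^* = inner z (A *m z).
  by apply/CrealP; rewrite ger0_real.
have := (real x, real y, real (x + y), real (x + 'i *: y)).
rewrite !mulmxDr -scalemxAr !innerDl !innerDr !innerZl !innerZr !inner_delta.
rewrite !rmorphD !rmorphM /= conjCK conjCi => -[[[-> ->] sumR] difR].
(* Entries and conjugates become independent variables for [ring]; all that is kept is that the two
   polarized values are real and that ['i] is nonzero. *)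
move: (A i i) (A j j) (A i j) (A j i) ('i : C) (neq0Ci C) sumR difR => p q r s.
move: (r^*) (s^*) => r' s' z z0 sumR difR.
have /eqP : 2 * z * (s' - r) = 0.
  transitivity (z * ((q + s' + (r' + p)) - (q + s + (r + p))) -
    ((q + - z * s' + (z * r' + z * (- z * p))) -
     (q + z * s + (- z * r + - z * (z * p))))); first by ring.
  by rewrite sumR difR !subrr mulr0 subr0.
by rewrite !mulf_eq0 pnatr_eq0 (negPf z0) /= subr_eq0 => /eqP.
Qed.

(** By the spectral theorem A = P^* D P with P unitary and D diagonal; D is nonnegative, so B =
    sqrt(D) P works. *)
Lemma psd_factor A :
  (forall x, 0 <= inner x (A *m x)) -> exists B : 'M_m, A = B ^t* *m B.
Proof.
move=> A_ge0; have Aherm := psd_hermitian _ A_ge0.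
have /orthomx_spectralP : A \is normalmx by apply/normalmxP; rewrite Aherm.
set P := spectralmx A; set d := spectral_diag A.
have := spectral_unitarymx A; rewrite -/P; move: P d => P d Pu.
rewrite invmx_unitary // => AE.
have PP : P *m P ^t* = 1%:M by apply/unitarymxP.
have d_ge0 i : 0 <= d 0 i.
  (* The test vector is column [i] of [P ^t*], an eigenvector of [A] for the eigenvalue [d 0 i]. *)
  have := A_ge0 (P ^t* *m delta_mx i 0).
  rewrite -[P in P ^t* *m _]trmxCK -inner_adj trmxCK !mulmxA AE.
  rewrite !mulmxA PP mul1mx -(mulmxA (diag_mx d)) PP mulmx1 inner_delta.
  by rewrite mxE eqxx mulr1n.
exists (diag_mx (\row_i sqrtC (d 0 i)) *m P).
rewrite trmxC_mul AE !mulmxA; congr (_ *m _).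
rewrite -mulmxA; congr (_ *m _).
apply/matrixP => i j; rewrite mul_mx_diag !mxE.
rewrite rmorphMn /= eq_sym; have [->|_] := eqVneq i j; last by rewrite mul0r.
by rewrite !mulr1n conj_Creal ?ger0_real ?sqrtC_ge0 // -expr2 sqrtCK.
Qed.
End Inner.

(** * Families whose span has dimension at most k *)

(** The [w t] are a spanning list of length [k], and orthonormality of [e] lets the numbers <v_t,
    e_i> be any prescribed coefficients. *)
Lemma dim_span_leP {C : numClosedFieldType} {m k d} {V : 'I_d -> 'cV[C]_m}
    {e : 'I_d -> 'cV[C]_d} (eon : orthonormal_basis e) :
  (\dim <<codom V>> <= k)%N <->
  exists (v : 'I_k -> 'cV_d) (w : 'I_k -> 'cV_m),
    forall i, V i = \sum_t inner (v t) (e i) *: w t.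
Proof.
split=> [dimV|[v [w VE]]]; last first.
  have /dimvS/leq_trans : (<<codom V>> <= <<codom w>>)%VS.
    apply/span_subvP => _ /codomP[i ->]; rewrite VE memv_suml // => t _.
    by rewrite memvZ // memv_span // codom_f.
  by apply; rewrite (leq_trans (dim_span _)) // size_codom card_ord.
set U := <<codom V>>%VS in dimV *.
(* With [t] a natural number, the sums up to [\dim U] and up to [k] share one summand; the default 0
   pads the coordinates from [\dim U] on. *)
pose c i (t : nat) := oapp (fun j => coord (vbasis U) j (V i)) 0 (insub t).
(* The conjugate cancels the antilinearity of [inner] in its first variable, so that <v_t, e_i> is
   [c i t]. *)
exists (fun t => \sum_i (c i t)^* *: e i), (fun t => (vbasis U)`_t) => i.
have -> : V i = \sum_(t < k) c i t *: (vbasis U)`_t.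
  rewrite {1}(coord_vbasis (memv_span (codom_f V i))) -/U.
  transitivity (\sum_(t < \dim U) c i t *: (vbasis U)`_t).
    by apply: eq_bigr => t _; rewrite /c valK.
  rewrite (big_ord_widen k (fun t => c i t *: (vbasis U)`_t)) // big_mkcond.
  apply: eq_bigr => t _; case: ifP => // tU.
  by rewrite /c insubF ?scale0r.
apply: eq_bigr => t _ /=; rewrite inner_suml (bigD1 i) //= big1 => [|j ji].
  by rewrite innerZl conjCK eon eqxx mulr1 addr0.
by rewrite innerZl eon (negPf ji) mulr0.
Qed.

(** * Positivity of block matrices *)

Lemma map_mxblock {T T' : Type} (f : T -> T') {p q : nat} {p_ : 'I_p -> nat}
    {q_ : 'I_q -> nat} (B : forall i j, 'M[T]_(p_ i, q_ j)) :
  map_mx f (\mxblock_(i, j) B i j) = \mxblock_(i, j) map_mx f (B i j).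
Proof. by apply/matrixP => i j; rewrite !mxE. Qed.

Lemma inner_mxcol {C : numClosedFieldType} {k} {m_ : 'I_k -> nat}
    (x y : forall s, 'cV[C]_(m_ s)) :
  inner (\mxcol_s x s) (\mxcol_s y s) = \sum_s inner (x s) (y s).
Proof.
rewrite /inner tr_mxcol.
have -> : map_mx Num.conj (\mxrow_s (x s)^T) = \mxrow_s (x s) ^t*.
  by apply/matrixP => i j; rewrite !mxE.
by rewrite mul_mxrow_mxcol summxE.
Qed.

Definition block_form {C : numClosedFieldType} {m k} (a : 'M['M[C]_m]_k)
    (w : 'I_k -> 'cV[C]_m) : C :=
  \sum_s \sum_t inner (w s) (a s t *m w t).

Lemma block_adj_mul {C : numClosedFieldType} {m k} (b : 'M['M[C]_m]_k) s t :
  (block_adj b *m b) s t = \sum_r (b r s) ^t* *m b r t.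
Proof. by rewrite mxE; apply: eq_bigr => r _; rewrite mxE. Qed.

(** The form of b^* b is a sum of squared norms. Conversely, the blocks are assembled into one
    scalar matrix, which [psd_factor] factors, and the factor is cut back into blocks. *)
Lemma block_positiveP {C : numClosedFieldType} {m k} (a : 'M['M[C]_m]_k) :
  block_positive a <-> forall w, 0 <= block_form a w.
Proof.
split=> [[b ->] w|a_ge0].
  suff -> : block_form (block_adj b *m b) w =
      \sum_r inner (\sum_s b r s *m w s) (\sum_s b r s *m w s).
    by apply: sumr_ge0 => r _; apply: inner_ge0.
  rewrite /block_form exchange_big; under [RHS]eq_bigr do rewrite inner_sumr.
  rewrite [RHS]exchange_big; apply: eq_bigr => t _ /=.
  under [RHS]eq_bigr do rewrite inner_suml.
  rewrite [RHS]exchange_big; apply: eq_bigr => s _ /=.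
  rewrite block_adj_mul mulmx_suml inner_sumr; apply: eq_bigr => r _.
  by rewrite -mulmxA inner_adj trmxCK.
pose M := \mxblock_(s < k, t < k) a s t.
have /psd_factor[B MB] x : 0 <= inner x (M *m x).
  have := a_ge0 (submxcol x); congr (0 <= _).
  rewrite -[in RHS](submxcolK x) mul_mxblock_mxrow inner_mxcol.
  by apply: eq_bigr => s _; rewrite inner_sumr.
exists (\matrix_(r, s) submxblock B r s).
apply/matrixP => s t; rewrite block_adj_mul.
have := congr1 (fun X => submxblock X s t) MB; rewrite mxblockK => ->.
rewrite -{1 2}(submxblockK B) tr_mxblock map_mxblock mul_mxblock mxblockK.
by apply: eq_bigr => r _; rewrite !mxE.
Qed.

(** * Orthonormal bases, the conjugation J_c and the transpose *)

Lemma mul_trmxC {C : numClosedFieldType} {m} (x y : 'cV[C]_m) :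
  x ^t* *m y = (inner x y)%:M.
Proof. exact: mx11_scalar. Qed.

Lemma orthonormal_expand {C : numClosedFieldType} {m} {e : 'I_m -> 'cV[C]_m}
    (eon : orthonormal_basis e) (x : 'cV_m) :
  x = \sum_i inner (e i) x *: e i.
Proof.
rewrite -{1}[x]mul1mx -(orthonormal_sum eon) mulmx_suml; apply: eq_bigr => i _.
by rewrite -mulmxA mul_trmxC mul_mx_scalar.
Qed.

Lemma inner_basis_conj {C : numClosedFieldType} {m} {e : 'I_m -> 'cV[C]_m}
    (eon : orthonormal_basis e) (x : 'cV_m) i :
  inner (e i) (basis_conj e x) = (inner (e i) x)^*.
Proof.
rewrite inner_sumr (bigD1 i) //= big1 => [|j ji].
  by rewrite innerZr eon eqxx mulr1 addr0.
by rewrite innerZr eon eq_sym (negPf ji) mulr0.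
Qed.

Lemma basis_conjK {C : numClosedFieldType} {m} {e : 'I_m -> 'cV[C]_m}
    (eon : orthonormal_basis e) : involutive (basis_conj e).
Proof.
move=> x; rewrite [RHS](orthonormal_expand eon); apply: eq_bigr => i _.
by rewrite inner_basis_conj // conjCK.
Qed.

Lemma basis_conjZ {C : numClosedFieldType} {m} (e : 'I_m -> 'cV[C]_m) c x :
  basis_conj e (c *: x) = c^* *: basis_conj e x.
Proof.
rewrite /basis_conj scaler_sumr; apply: eq_bigr => i _.
by rewrite innerZr rmorphM scalerA.
Qed.

Lemma basis_conj_sum {C : numClosedFieldType} {m} (I : finType)
    (e : 'I_m -> 'cV[C]_m) (x : I -> 'cV_m) :
  basis_conj e (\sum_t x t) = \sum_t basis_conj e (x t).
Proof.
rewrite /basis_conj exchange_big; apply: eq_bigr => i _ /=.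
by rewrite inner_sumr rmorph_sum scaler_suml.
Qed.

(** Both sides are the bilinear sum of the products <e_i, x> <e_i, y>. *)
Lemma inner_basis_conjl {C : numClosedFieldType} {m} {e : 'I_m -> 'cV[C]_m}
    (eon : orthonormal_basis e) (x y : 'cV_m) :
  inner (basis_conj e x) y = (inner x (basis_conj e y))^*.
Proof.
rewrite [in LHS](orthonormal_expand eon y) inner_sumr inner_sumr rmorph_sum.
apply: eq_bigr => i _; rewrite !innerZr rmorphM /= conjCK; congr (_ * _).
by rewrite -[LHS]inner_conj inner_basis_conj // !inner_conj.
Qed.

(** Moving the outer J_c of J_c a^* J_c to the other side conjugates the inner product, which swaps
    its arguments. This removes the transpose from (iii). *)
Lemma inner_basis_tr {C : numClosedFieldType} {m} {e : 'I_m -> 'cV[C]_m}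
    (eon : orthonormal_basis e) a (x y : 'cV_m) :
  inner x (basis_tr e a y) = inner (basis_conj e y) (a *m basis_conj e x).
Proof.
by rewrite inner_adj /basis_tr -inner_conj inner_basis_conjl // conjCK.
Qed.

Lemma orthonormal_delta {C : numClosedFieldType} {m} :
  orthonormal_basis (fun i => delta_mx i 0 : 'cV[C]_m).
Proof. by move=> i j; rewrite -[delta_mx j 0]mul1mx inner_delta mxE. Qed.

(** J_c is only antilinear, so it is applied to the expansion from [dim_span_leP], whose
    coefficients it conjugates. The standard basis of C^d merely encodes these coefficients. *)
Lemma dim_span_basis_conj {C : numClosedFieldType} {m d k}
    {e : 'I_m -> 'cV[C]_m} {V : 'I_d -> 'cV_m} :
  (\dim <<codom V>> <= k)%N -> (\dim <<codom (basis_conj e \o V)>> <= k)%N.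
Proof.
pose eps (i : 'I_d) : 'cV[C]_d := delta_mx i 0.
have eps_on : orthonormal_basis eps := orthonormal_delta.
move=> /(dim_span_leP eps_on)[v [w VE]]; apply/(dim_span_leP eps_on).
exists (basis_conj eps \o v), (basis_conj e \o w) => i /=.
rewrite VE basis_conj_sum; apply: eq_bigr => t _; rewrite basis_conjZ.
by rewrite -[in RHS]inner_conj inner_basis_conj // !inner_conj.
Qed.

(** * The form Q and its expansions in the two bases *)

Definition rank1_form {C : numClosedFieldType} {m n k}
    (phi : 'M[C]_m -> 'M[C]_n) (v : 'I_k -> 'cV_m) (w : 'I_k -> 'cV_n) : C :=
  \sum_s \sum_t inner (w s) (phi (v s *m (v t) ^t*) *m w t).

Lemma k_positiveP {C : numClosedFieldType} {m n k}
    (phi : {linear 'M[C]_m -> 'M[C]_n}) :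
  k_positive k phi <-> forall v w, 0 <= rank1_form (k := k) phi v w.
Proof.
split=> [phik v w|form_ge0 _ [b ->]].
  have /phik/block_positiveP/(_ w) :
      block_positive (\matrix_(s < k, t < k) (v s *m (v t) ^t*)).
    apply/block_positiveP => u.
    (* The matrix [v_s v_t^* ] is positive because its form is a squared modulus. *)
    suff -> : block_form (\matrix_(s < k, t < k) (v s *m (v t) ^t*)) u =
        (\sum_t inner (v t) (u t)) * (\sum_t inner (v t) (u t))^*.
      exact: mul_conjC_ge0.
    rewrite mulrC rmorph_sum mulr_suml; apply: eq_bigr => s _.
    rewrite mulr_sumr; apply: eq_bigr => t _.
    rewrite mxE -mulmxA mul_trmxC mul_mx_scalar innerZr.
    by rewrite mulrC /= inner_conj.
  congr (0 <= _); apply: eq_bigr => s _; apply: eq_bigr => t _.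
  by rewrite !mxE.
apply/block_positiveP => w.
(* Inserting the identity as a sum of diagonal matrix units between b_rs^* and b_rt splits b^* b
   into rank-one pieces, one for each [r] and [l]. *)
suff -> : block_form (map_mx phi (block_adj b *m b)) w =
    \sum_r \sum_l rank1_form phi (fun s => (b r s) ^t* *m delta_mx l 0) w.
  by apply: sumr_ge0 => r _; apply: sumr_ge0 => l _; apply: form_ge0.
rewrite pair_bigA exchange_big /block_form /=; apply: eq_bigr => s _.
rewrite exchange_big; apply: eq_bigr => t _ /=.
rewrite mxE block_adj_mul linear_sum -(pair_bigA _ (fun r l => inner (w s)
  (phi ((b r s) ^t* *m delta_mx l 0 *m ((b r t) ^t* *m delta_mx l 0) ^t*)
     *m w t))) /=.
rewrite mulmx_suml inner_sumr; apply: eq_bigr => r _.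
rewrite -inner_sumr -mulmx_suml -linear_sum; congr (inner _ (phi _ *m _)).
rewrite -[X in X *m _]mulmx1 mx1_sum_delta mulmx_sumr mulmx_suml.
apply: eq_bigr => l _.
rewrite trmxC_mul trmxCK trmxC_delta !mulmxA.
by rewrite -(mulmxA _ (delta_mx l 0)) mul_delta_mx.
Qed.

Lemma rank1_form_h {C : numClosedFieldType} {m n k} {e : 'I_m -> 'cV[C]_m}
    (eon : orthonormal_basis e) (phi : {linear 'M[C]_m -> 'M[C]_n})
    (v : 'I_k -> 'cV_m) (w : 'I_k -> 'cV_n) :
  let y i := \sum_t inner (v t) (e i) *: w t in
  rank1_form phi v w = \sum_i \sum_j inner (y j) (phi (mx_unit e i j) *m y i).
Proof.
move=> y.
(* Here E_ij is e_j e_i^*, so [j] comes from expanding [v s] and [i] from expanding [v t]. *)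
have E s t : v s *m (v t) ^t* =
    \sum_i \sum_j (inner (e j) (v s) * inner (v t) (e i)) *: mx_unit e i j.
  rewrite -[LHS]mulmx1 -(orthonormal_sum eon) mulmx_sumr; apply: eq_bigr => i _.
  rewrite {1}[v s](orthonormal_expand eon) !mulmx_suml; apply: eq_bigr => j _.
  rewrite -!scalemxAl !mulmxA -(mulmxA _ _ (e i)) mul_trmxC mul_mx_scalar.
  by rewrite -scalemxAl scalerA.
transitivity (\sum_s \sum_t \sum_i \sum_j
    (inner (e j) (v s) * inner (v t) (e i)) *
      inner (w s) (phi (mx_unit e i j) *m w t)).
  apply: eq_bigr => s _; apply: eq_bigr => t _.
  rewrite E linear_sum mulmx_suml inner_sumr; apply: eq_bigr => i _ /=.
  rewrite linear_sum mulmx_suml inner_sumr; apply: eq_bigr => j _ /=.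
  by rewrite linearZ -scalemxAl innerZr.
under eq_bigr do rewrite exchange_big /=.
rewrite exchange_big; apply: eq_bigr => i _ /=.
under eq_bigr do rewrite exchange_big /=.
rewrite exchange_big; apply: eq_bigr => j _ /=.
rewrite inner_suml; apply: eq_bigr => s _.
rewrite /y mulmx_sumr inner_sumr; apply: eq_bigr => t _.
by rewrite innerZl -scalemxAr innerZr inner_conj mulrA.
Qed.

(** The trace of v_s v_t^* g_qp is <v_t, g_qp v_s>, so [t] moves to the left argument and [s] to the
    right one. The vector [x p] plays the role of J_c x_p in (iii). *)
Lemma rank1_form_g {C : numClosedFieldType} {m n k} {f : 'I_n -> 'cV[C]_n}
    (phi : 'M[C]_m -> 'M[C]_n) (g : 'I_n -> 'I_n -> 'M[C]_m)
    (phiE : forall a, phi a =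
       \sum_(p < n) \sum_(q < n) \tr (a *m g q p) *: mx_unit f p q)
    (v : 'I_k -> 'cV_m) (w : 'I_k -> 'cV_n) :
  let x p := \sum_t inner (w t) (f p) *: v t in
  rank1_form phi v w = \sum_p \sum_q inner (x p) (g q p *m x q).
Proof.
move=> x.
transitivity (\sum_s \sum_t \sum_p \sum_q
    inner (v t) (g q p *m v s) * (inner (f p) (w t) * inner (w s) (f q))).
  apply: eq_bigr => s _; apply: eq_bigr => t _.
  rewrite phiE mulmx_suml inner_sumr; apply: eq_bigr => p _.
  rewrite mulmx_suml inner_sumr; apply: eq_bigr => q _.
  rewrite -scalemxAl mx_unitE !innerZr; congr (_ * _).
  by rewrite -mulmxA mxtrace_mulC -mulmxA mul_trmxC mxtrace_scalar.
under eq_bigr do rewrite exchange_big /=.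
rewrite exchange_big; apply: eq_bigr => p _ /=.
under eq_bigr do rewrite exchange_big /=.
rewrite exchange_big; apply: eq_bigr => q _ /=.
rewrite exchange_big /= inner_suml; apply: eq_bigr => t _.
rewrite /x mulmx_sumr inner_sumr; apply: eq_bigr => s _.
by rewrite innerZl -scalemxAr innerZr inner_conj mulrC mulrA.
Qed.

Theorem theorem3p1 (R : realType) (m n k : nat)
    (e : 'I_m -> 'cV[R[i]]_m) (f : 'I_n -> 'cV[R[i]]_n)
    (he : orthonormal_basis e) (hf : orthonormal_basis f)
    (phi : {linear 'M[R[i]]_m -> 'M[R[i]]_n})
    (h : 'I_m -> 'I_m -> 'M[R[i]]_n) (g : 'I_n -> 'I_n -> 'M[R[i]]_m)
    (hh : forall i j : 'I_m, h i j = phi (mx_unit e i j))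
    (hg : forall a : 'M[R[i]]_m,
        phi a = \sum_(p < n) \sum_(q < n) \tr (a *m g q p) *: mx_unit f p q) :
  [<-> k_positive k phi;
       forall y : 'I_m -> 'cV[R[i]]_n,
         (\dim <<codom y>> <= k)%N ->
         0 <= \sum_(i < m) \sum_(j < m) inner (y j) (h i j *m y i);
       forall x : 'I_n -> 'cV[R[i]]_m,
         (\dim <<codom x>> <= k)%N ->
         0 <= \sum_(p < n) \sum_(q < n) inner (x p) (basis_tr e (g p q) (x q))].
Proof.
have eq_h y v w : (forall i, y i = \sum_t inner (v t) (e i) *: w t) ->
    \sum_i \sum_j inner (y j) (h i j *m y i) = rank1_form (k := k) phi v w.
  move=> yE; rewrite (rank1_form_h he).
  by apply: eq_bigr => i _; apply: eq_bigr => j _; rewrite hh !yE.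
have eq_g x v w :
    (forall p, basis_conj e (x p) = \sum_t inner (w t) (f p) *: v t) ->
    \sum_p \sum_q inner (x p) (basis_tr e (g p q) (x q)) =
    rank1_form (k := k) phi v w.
  (* Exchanging [p] and [q] matches the swap of arguments made by [inner_basis_tr]. *)
  move=> xE; rewrite (rank1_form_g _ _ hg) exchange_big /=.
  apply: eq_bigr => p _; apply: eq_bigr => q _.
  by rewrite (inner_basis_tr he) !xE.
tfae.
- move=> /k_positiveP phik y /(dim_span_leP he)[v [w yE]].
  by rewrite (eq_h _ _ _ yE).
- move=> y_ge0 x /(dim_span_basis_conj (e := e))/(dim_span_leP hf)[w [v xE]].
  (* The coefficients of J_c x give [v] and [w]; these define a family [y] with the same value of Q,
     to which (ii) applies. *)
  rewrite (eq_g _ _ _ xE) -(eq_h _ v w (fun=> erefl)).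
  by apply: y_ge0; apply/(dim_span_leP he); exists v, w.
- move=> x_ge0; apply/k_positiveP => v w.
  pose x p := \sum_t inner (w t) (f p) *: v t.
  (* Condition (iii) is used at J_c x, since its sum applies J_c once more. *)
  rewrite -(eq_g (basis_conj e \o x)); last by move=> p; rewrite /= basis_conjK.
  apply: x_ge0; apply: dim_span_basis_conj.
  by apply/(dim_span_leP hf); exists w, v.
Qed.
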